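(* Let $n\ge1$. Each of the sets $\{\mathrm{ez}^{(n)}_m\}_{m=1}^n$, $\{\mathrm{hz}^{(n)}_m\}_{m=1}^n$, $\{\mathrm{pz}^{(n)}_m\}_{m=1}^n$ is a minimal generating subset of the unital algebra $\operatorname{Sym}_n$, and the homomorphism $\Phi_n\colon\operatorname{Sym}_{2n}\to\operatorname{Sym}_n$ is surjective.
   Context: $\operatorname{Sym}_N$ is the unital algebra of symmetric polynomials in $N$ variables over $\mathbb{C}$. For $P\in\operatorname{Sym}_{2n}$, $\Phi_n(P)$ is the unique $Q\in\operatorname{Sym}_n$ with $P(x_1,\ldots,x_n,x_1^{-1},\ldots,x_n^{-1})=Q(x_1+x_1^{-1},\ldots,x_n+x_n^{-1})$ (existence and uniqueness hold); $\Phi_n$ is a homomorphism of algebras. $\mathrm{e}_m^{(N)},\mathrm{h}_m^{(N)},\mathrm{p}_m^{(N)}$ are the elementary, complete homogeneous, and power sum symmetric polynomials in $N$ variables, and $\mathrm{ez}^{(n)}_m=\Phi_n(\mathrm{e}^{(2n)}_m)$, $\mathrm{hz}^{(n)}_m=\Phi_n(\mathrm{h}^{(2n)}_m)$, $\mathrm{pz}^{(n)}_m=\Phi_n(\mathrm{p}^{(2n)}_m)$. A generating subset of a unital algebra is minimal if no proper subset of it generates the algebra (as a unital algebra). *)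

(* Defs.v *)
From HB Require Import structures.
From mathcomp Require Import all_boot all_order all_fingroup all_algebra.
From mathcomp Require Import mpoly zify.
From mathcomp Require Import classical_sets reals complex.

Set Implicit Arguments.
Unset Strict Implicit.
Unset Printing Implicit Defensive.

Import Order.TTheory GRing.Theory Num.Theory.

Local Open Scope ring_scope.
Local Open Scope classical_set_scope.

Section Generation.
Variables (K : fieldType) (A : algType K).

(* [subalg_closed] requires 1 to belong to the subalgebra. *)
Definition generated_algebra (S : set A) : set A :=
  smallest (fun D : set A => GRing.subalg_closed (mem D)) S.

Definition generates (S : set A) : Prop := generated_algebra S = [set: A].

Definition minimal_generating (S : set A) : Prop :=
  generates S /\ forall T : set A, T `<` S -> ~ generates T.

End Generation.

Section SymmetricPolynomials.
Variables (K : fieldType) (N : nat).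

Record Sym := MkSym { symval :> {mpoly K[N]}; symvalP : symval \is symmetric }.

HB.instance Definition _ := [isSub of Sym for symval].
HB.instance Definition _ := [Choice of Sym by <:].
HB.instance Definition _ := [SubChoice_isSubZmodule of Sym by <:].
HB.instance Definition _ := [SubZmodule_isSubLmodule of Sym by <:].
HB.instance Definition _ := [SubZmodule_isSubNzRing of Sym by <:].
HB.instance Definition _ := [SubNzRing_isSubComNzRing of Sym by <:].
HB.instance Definition _ := [SubNzRing_SubLmodule_isSubLalgebra of Sym by <:].
HB.instance Definition _ := [SubLalgebra_isSubAlgebra of Sym by <:].

End SymmetricPolynomials.

Section NamedSymmetricPolynomials.
Variables (K : fieldType) (N : nat).

Definition hsym (m : nat) : {mpoly K[N]} :=
  \sum_(a : 'X_{1..N < m.+1} | mdeg a == m) 'X_[a].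

Definition psym (m : nat) : {mpoly K[N]} := \sum_(i < N) 'X_i ^+ m.

Lemma mcoeff_hsym m a : (hsym m)@_a = (mdeg a == m)%:R.
Proof.
rewrite /hsym raddf_sum /=; have [am|am] := eqVneq (mdeg a) m; last first.
  rewrite big1 // => b /eqP bm; rewrite mcoeffX.
  by case: eqP => // ba; rewrite -bm ba eqxx in am.
have lta : (mdeg a < m.+1)%N by rewrite am.
rewrite (bigD1 (BMultinom lta)) /=; last by rewrite am.
rewrite mcoeffX eqxx big1 ?addr0 // => b /andP[_ ne].
by rewrite mcoeffX; case: eqP => // ba; case/eqP: ne; apply/val_inj.
Qed.

Lemma hsym_sym m : hsym m \is symmetric.
Proof.
apply/issymP => s; apply/mpolyP => a.
by rewrite mcoeff_sym !mcoeff_hsym mdeg_mperm.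
Qed.

Lemma psym_sym m : psym m \is symmetric.
Proof.
apply/issymP => s; rewrite /psym raddf_sum /= (reindex_inj (@perm_inj _ s^-1%g)).
apply: eq_bigr => i _ /=; rewrite rmorphXn /=; congr (_ ^+ _).
rewrite msymX; f_equal; apply/mnmP => j.
by rewrite !mnmE (inj_eq (@perm_inj _ s^-1%g)).
Qed.

Definition eS (m : nat) : Sym K N := MkSym (mesym_sym N K m).
Definition hS (m : nat) : Sym K N := MkSym (hsym_sym m).
Definition pS (m : nat) : Sym K N := MkSym (psym_sym m).

End NamedSymmetricPolynomials.

Section Substitutions.
Variables (K : fieldType) (n : nat).

(* Identities between Laurent polynomials in x_1, ..., x_n are read in the    *)
(* field of fractions of K[x_1, ..., x_n].                                    *)
Definition xvar (i : 'I_n) : {fraction {mpoly K[n]}} := tofrac 'X_i.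

Definition constf : K -> {fraction {mpoly K[n]}} := @tofrac _ \o @mpolyC n K.

HB.instance Definition _ := GRing.RMorphism.on constf.

(* P(x_1, ..., x_n, x_1^-1, ..., x_n^-1) *)
Definition eval_inv : {mpoly K[n + n]} -> {fraction {mpoly K[n]}} :=
  mmap constf (fun i => match split i with
                        | inl j => xvar j
                        | inr j => (xvar j)^-1
                        end).

(* Q(x_1 + x_1^-1, ..., x_n + x_n^-1) *)
Definition eval_sum : {mpoly K[n]} -> {fraction {mpoly K[n]}} :=
  mmap constf (fun j => xvar j + (xvar j)^-1).

HB.instance Definition _ := GRing.RMorphism.on eval_inv.
HB.instance Definition _ := GRing.RMorphism.on eval_sum.

Lemma tofrac_inj : injective (@tofrac {mpoly K[n]}).
Proof. by move=> p q /eqP; rewrite tofrac_eq => /eqP. Qed.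

Lemma mpolyX_neq0 m : 'X_[m] != 0 :> {mpoly K[n]}.
Proof. by rewrite -msupp_eq0 msuppX. Qed.

Lemma xvar_neq0 i : xvar i != 0.
Proof. by rewrite /xvar tofrac_eq0 mpolyX_neq0. Qed.

Lemma eval_invZ c P : eval_inv (c *: P) = constf c * eval_inv P.
Proof. exact: mmapZ. Qed.

Lemma eval_sumZ c Q : eval_sum (c *: Q) = constf c * eval_sum Q.
Proof. exact: mmapZ. Qed.

(* Multiplying [eval_sum Q] by a large power of [x_1 ... x_n] clears the      *)
(* denominators and turns the monomial ['X_[m]] into a polynomial of leading  *)
(* monomial [(d, ..., d) + m].                                                *)
Let cleared (d : nat) (m : 'X_{1..n}) : {mpoly K[n]} :=
  \prod_(i < n) ('X_i ^+ (d - m i) * ('X_i ^+ 2 + 1) ^+ m i).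

Let lead_sq (i : 'I_n) : mlead ('X_i ^+ 2 + 1 : {mpoly K[n]}) = (U_(i) *+ 2)%MM.
Proof.
have e : mlead ('X_i ^+ 2 : {mpoly K[n]}) = (U_(i) *+ 2)%MM.
  by rewrite mpolyXn mleadXm.
rewrite mleadDl e // mlead1 lt_neqAle le0m andbT.
by apply/eqP => /mnmP /(_ i); rewrite mulmnE mnmE mnmE eqxx.
Qed.

Let sq_neq0 (i : 'I_n) : 'X_i ^+ 2 + 1 != 0 :> {mpoly K[n]}.
Proof.
apply/eqP => /(congr1 (@mlead n K)); rewrite lead_sq mlead0 => /mnmP /(_ i).
by rewrite mulmnE mnmE mnmE eqxx.
Qed.

Let cleared_neq0 d m : cleared d m != 0.
Proof.
by apply/prodf_neq0 => i _; rewrite mulf_neq0 ?expf_neq0 ?mpolyX_neq0.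
Qed.

Let lead_cleared d (m : 'X_{1..n}) : (forall i, m i <= d)%N ->
  mlead (cleared d m) = ([multinom d | _ < n] + m)%MM.
Proof.
move=> md; rewrite /cleared mlead_prod => [|i _ _]; last first.
  by rewrite mulf_neq0 ?expf_neq0 ?mpolyX_neq0.
transitivity (\sum_(i < n) U_(i) *+ (d + m i))%MM.
  apply: eq_bigr => i _; rewrite mleadM ?expf_neq0 ?mpolyX_neq0 //.
  rewrite mpolyXn mleadXm mleadX // lead_sq; apply/mnmP => j.
  rewrite mnmDE !mulmnE -mulnA -mulnDr; congr (_ * _)%N.
  by have := md i; lia.
rewrite [RHS]multinomUE_id; apply: eq_bigr => i _.
by rewrite mnmDE mnmE.
Qed.

Let clear_denominators Q :
  tofrac (\prod_(i < n) 'X_i ^+ msize Q) * eval_sum Q =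
  tofrac (\sum_(m <- msupp Q) Q@_m *: cleared (msize Q) m).
Proof.
rewrite /eval_sum /mmap mulr_sumr rmorph_sum big_seq [RHS]big_seq.
apply: eq_bigr => m mQ; rewrite -mul_mpolyC rmorphM /= mulrCA; congr (_ * _).
rewrite /mmap1 !rmorph_prod /= -big_split /=; apply: eq_bigr => i _.
have mi : (m i <= msize Q)%N.
  rewrite (leq_trans _ (ltnW (msize_mdeg_lt mQ))) // mdegE (bigD1 i) //=.
  exact: leq_addr.
rewrite rmorphM !rmorphXn /= -{1}(subnK mi) exprD -mulrA -exprMn.
rewrite rmorphD rmorphXn rmorph1 /= mulrDr mulfV; last exact: xvar_neq0.
by rewrite -expr2.
Qed.

Lemma eval_sum_inj : injective eval_sum.
Proof.
suff inj0 Q : eval_sum Q = 0 -> Q = 0.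
  move=> p q /eqP; rewrite -subr_eq0 -rmorphB /= => /eqP /inj0 /eqP.
  by rewrite subr_eq0 => /eqP.
move=> Q0; apply/eqP; apply: contraTT isT => nzQ.
have /esym := clear_denominators Q; rewrite Q0 mulr0 -tofrac0 => /tofrac_inj.
set d := msize Q; have md m : m \in msupp Q -> forall i, (m i <= d)%N.
  move=> mQ i; rewrite (leq_trans _ (ltnW (msize_mdeg_lt mQ))) // mdegE.
  by rewrite (bigD1 i) //= leq_addr.
have leadQ := mlead_supp nzQ.
move/(congr1 (mcoeff (mlead (cleared d (mlead Q))))).
rewrite mcoeff0 (bigD1_seq (mlead Q)) ?msupp_uniq //= mcoeffD mcoeffZ.
rewrite big_seq_cond raddf_sum big1 => [|m /andP[mQ ne]].
  move/eqP; rewrite addr0 mulf_eq0 !mleadc_eq0 (negPf nzQ).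
  by rewrite (negPf (cleared_neq0 _ _)).
rewrite /= mcoeffZ [X in _ * X]mcoeff_gt_mlead ?mulr0 //.
rewrite (lead_cleared (md _ mQ)) (lead_cleared (md _ leadQ)).
by rewrite ltmc_add2r lt_neqAle ne msupp_le_mlead.
Qed.

Lemma eval_mPo (k : nat) (L : comNzRingType) (f : {rmorphism K -> L})
    (h : 'I_k -> L) (N : nat) (q : N.-tuple {mpoly K[k]}) (t : {mpoly K[N]}) :
  mmap f h (t \mPo q) = mmap f (fun i => mmap f h (tnth q i)) t.
Proof.
rewrite comp_mpolyEX raddf_sum [RHS]/mmap; apply: eq_bigr => m _ /=.
rewrite mmapZ comp_mpolyX rmorph_prod; congr (_ * _).
by apply: eq_bigr => i _; rewrite rmorphXn.
Qed.

Lemma eval_mesym (N : nat) (L : comNzRingType) (f : {rmorphism K -> L})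
    (z : 'I_N -> L) (k : nat) :
  mmap f z (mesym N K k) = (\prod_(i < N) (1 + z i *: 'X))`_k.
Proof.
under [in RHS]eq_bigr => i _ do rewrite addrC.
rewrite bigA_distr coef_sum /mesym raddf_sum /= big_mkcond /=.
apply: eq_bigr => J _; rewrite -big_mkcond /=.
under [in RHS]eq_bigr => i _ do rewrite -mul_polyC.
rewrite big_split /= prodr_const -rmorph_prod /= coefCM coefXn eq_sym.
have [_|_] := eqVneq #|J| k; last by rewrite mulr0.
rewrite mulr1 rmorph_prod; apply: eq_bigr => i _ /=.
by rewrite mmapX mmap1U.
Qed.

(* (1 + x t)(1 + x^-1 t) = 1 + (x + x^-1) t + t^2: the coefficients of [zhuk] *)
(* at x_i + x_i^-1 are the elementary symmetric polynomials evaluated at the  *)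
(* x_i and x_i^-1.                                                            *)
Let zhuk (L : nzRingType) (y : 'I_n -> L) : {poly L} :=
  \prod_(i < n) (1 + y i *: 'X + 'X^2).

Let zhuk_split :
  \prod_(i < n + n) (1 + match split i with
                          | inl j => xvar j
                          | inr j => (xvar j)^-1
                          end *: 'X) =
  zhuk (fun j => xvar j + (xvar j)^-1).
Proof.
rewrite big_split_ord /= -big_split /=; apply: eq_bigr => i _ /=.
rewrite (unsplitK (inl i)) (unsplitK (inr i)).
rewrite mulrDl mul1r mulrDr mulr1 -scalerAl -scalerAr scalerA.
rewrite mulfV ?xvar_neq0 // scale1r -expr2 scalerDl !addrA.
by congr (_ + _); rewrite addrAC.
Qed.

Let zhuk_sym k : (zhuk (fun i => 'X_i : {mpoly K[n]}))`_k \is symmetric.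
Proof.
apply/issymP => s; rewrite -coef_map; congr ((_ : {poly _})`_k).
rewrite /zhuk rmorph_prod /= [RHS](reindex_inj (@perm_inj _ s)).
apply: eq_bigr => i _ /=.
rewrite !rmorphD rmorph1 /= map_polyZ map_polyXn map_polyX /= msymX.
congr (_ + _ *: _ + _); f_equal; apply/mnmP => j.
by rewrite !mnmE -{2}(permKV s j) (inj_eq (@perm_inj _ s)).
Qed.

Lemma Phi_exists (P : Sym K (n + n)) :
  exists Q : Sym K n, eval_inv P == eval_sum Q.
Proof.
pose E := [tuple (zhuk (fun i => 'X_i : {mpoly K[n]}))`_i.+1 | i < n + n].
have Esym : symf (symval P) \mPo E \is symmetric.
  by apply: mcomp_sym => i; rewrite -tnth_nth tnth_mktuple zhuk_sym.
exists (MkSym Esym); apply/eqP => /=; rewrite [in LHS](symfP (symvalP P)).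
rewrite /eval_inv /eval_sum !eval_mPo /=.
apply: eq_bigr => m _; congr (_ * _); apply: mmap1_eq => i.
rewrite !tnth_mktuple eval_mesym zhuk_split.
rewrite -[mmap _ _]/eval_sum -coef_map; congr ((_ : {poly _})`_(i.+1)).
rewrite /zhuk rmorph_prod /=; apply: eq_bigr => j _ /=.
rewrite !rmorphD rmorph1 /= map_polyZ map_polyXn map_polyX /=.
by rewrite /eval_sum mmapX mmap1U.
Qed.

Definition Phi (P : Sym K (n + n)) : Sym K n := xchoose (Phi_exists P).

Lemma PhiE (P : Sym K (n + n)) : eval_inv P = eval_sum (Phi P).
Proof. exact/eqP/(xchooseP (Phi_exists P)). Qed.

Lemma Phi_unique (P : Sym K (n + n)) (Q : Sym K n) : eval_inv P = eval_sum Q -> Phi P = Q.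
Proof. by rewrite PhiE => /eval_sum_inj /val_inj. Qed.

Fact Phi_is_zmod_morphism : zmod_morphism Phi.
Proof.
move=> P Q; apply: Phi_unique.
by rewrite !raddfB /= !PhiE.
Qed.

Fact Phi_is_monoid_morphism : monoid_morphism Phi.
Proof.
split=> [|P Q]; apply: Phi_unique; first by rewrite !rmorph1.
by rewrite !rmorphM /= !PhiE.
Qed.

Fact Phi_is_scalable : scalable Phi.
Proof.
move=> c P; apply: Phi_unique.
by rewrite [LHS](eval_invZ c P) [RHS](eval_sumZ c (Phi P)) PhiE.
Qed.

HB.instance Definition _ :=
  GRing.isZmodMorphism.Build (Sym K (n + n)) (Sym K n) Phi Phi_is_zmod_morphism.
HB.instance Definition _ :=
  GRing.isMonoidMorphism.Build (Sym K (n + n)) (Sym K n) Phi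
    Phi_is_monoid_morphism.
HB.instance Definition _ :=
  GRing.isScalable.Build K (Sym K (n + n)) (Sym K n) *:%R Phi Phi_is_scalable.

End Substitutions.

Definition ez (K : fieldType) (n m : nat) : Sym K n := Phi (eS K (n + n) m).
Definition hz (K : fieldType) (n m : nat) : Sym K n := Phi (hS K (n + n) m).
Definition pz (K : fieldType) (n m : nat) : Sym K n := Phi (pS K (n + n) m).

(* Main.v *)
From HB Require Import structures.
Require Import Defs.
From mathcomp Require Import all_boot all_order all_algebra ring.
From mathcomp Require Import mpoly.
From mathcomp Require Import boolp classical_sets reals complex.

(** Write [e_k] for the elementary symmetric polynomials of [n] variables; they
generate [Sym_n] by the fundamental theorem of symmetric polynomials.

Generation.  With [y_i = x_i + x_i^-1], the two factors belonging to [x_i] in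
the generating function of the elementary symmetric polynomials of the [2n]
variables merge into [1 + y_i t + t^2], so [ez_m] is the coefficient of [t^m] in
[\prod_i ((1 + t^2) + y_i t) = \sum_k e_k(y) t^k (1 + t^2)^(n - k)]
([ez_expand]).  Hence [ez_m] is [e_m] plus a linear combination of the [e_k] with
[k < m], and the [ez_m] generate ([ez_generates]).  The recursions expressing the
elementary symmetric polynomials of the [2n] variables through the complete
homogeneous ones ([hsym_identity]) and through the power sums
([psym_identity]) are carried to [Sym_n] by the homomorphism [Phi], and show
that the [hz_m] and the [pz_m] generate as well.  Since the image of [Phi] is a
subalgebra containing the [ez_m], [Phi] is surjective.

Minimality holds for every family [f_1, ..., f_n] that generates [Sym_n]
([generating_family_minimal]), because fewer than [n] elements never suffice.
Take a point [x] with distinct coordinates.  The gradients at [x] of [n - 1]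
elements are all killed by some nonzero vector [v]; as the derivative
at [x] along [v] is a derivation, it then kills the subalgebra which these
elements generate.  It cannot kill all of [Sym_n]: on the power sums of degree
[1, ..., n] it takes the values [k \sum_i v_i x_i^(k-1)], and these do not all
vanish, by the nonvanishing of the Vandermonde determinant
([dirderiv_separates]). *)

Import GRing.Theory Num.Theory.
Local Open Scope ring_scope.
Local Open Scope classical_set_scope.
Local Open Scope complex_scope.

(** * Generated subalgebras *)

(** The boolean membership predicate of [generated_algebra]: a named constant,
so that it can carry the closure structure used by the [rpred] lemmas. *)
Definition in_generated {K : fieldType} {A : algType K} (S : set A) : {pred A} :=
  mem (generated_algebra S).

Lemma generated_subalg_closed {K : fieldType} {A : algType K} (S : set A) :
  GRing.subalg_closed (in_generated S).
Proof.
split=> [|a u v|u v]; rewrite /in_generated !inE.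
- by move=> D [[/set_mem D1 _ _] _].
- move=> Su Sv D DS; have [[_ DZ _] _] := DS.
  by apply/set_mem/DZ; apply/mem_set; [apply: Su | apply: Sv].
- move=> Su Sv D DS; have [[_ _ DM] _] := DS.
  by apply/set_mem/DM; apply/mem_set; [apply: Su | apply: Sv].
Qed.

HB.instance Definition _ (K : fieldType) (A : algType K) (S : set A) :=
  GRing.isSubalgClosed.Build K A (in_generated S) (generated_subalg_closed S).

Lemma generated_min {K : fieldType} {A : algType K} (S D : set A) :
  GRing.subalg_closed (mem D) -> S `<=` D -> generated_algebra S `<=` D.
Proof. by move=> cD SD; apply: smallest_sub. Qed.

Lemma mem_generated {K : fieldType} {A : algType K} (S : set A) x :
  S x -> x \in in_generated S.
Proof. by move=> Sx; rewrite inE; apply: sub_gen_smallest. Qed.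

Lemma generates_trans {K : fieldType} {A : algType K} (S T : set A) :
  (forall x, S x -> x \in in_generated T) -> generates S -> generates T.
Proof.
move=> ST genS; apply/seteqP; split=> // x _.
have: generated_algebra S x by rewrite genS.
apply: generated_min => [|y /ST]; last by rewrite inE.
exact: generated_subalg_closed.
Qed.

(** * The fundamental theorem as a statement about generation *)

(* The morphism structure belongs to the subtype projection [val]; the coercion
[symval], a different head constant, receives it here. *)
HB.instance Definition _ (K : fieldType) (N : nat) :=
  GRing.isZmodMorphism.Build (Sym K N) {mpoly K[N]} (@symval K N)
    (raddfB (val : Sym K N -> {mpoly K[N]})).
HB.instance Definition _ (K : fieldType) (N : nat) :=
  GRing.isMonoidMorphism.Build (Sym K N) {mpoly K[N]} (@symval K N)
    (rmorph1 (val : Sym K N -> {mpoly K[N]}),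
     rmorphM (val : Sym K N -> {mpoly K[N]})).
HB.instance Definition _ (K : fieldType) (N : nat) :=
  GRing.isScalable.Build K (Sym K N) {mpoly K[N]} *:%R (@symval K N)
    (linearZ_LR (val : Sym K N -> {mpoly K[N]})).

(** [symfP] writes [p] as a polynomial in the elementary symmetric polynomials;
only the monomials of that polynomial have to be moved to [Sym K N]. *)
Lemma eS_generates (K : fieldType) (N : nat) :
  generates [set eS K N m | m in [set m | (1 <= m <= N)%N]].
Proof.
apply/seteqP; split=> // p _; apply/set_mem; set S := [set _ | _ in _].
have -> : p = \sum_(m <- msupp (symf p)) (symf p)@_m *:
    \prod_(i < N) eS K N i.+1 ^+ m i.
  apply/val_inj => /=; rewrite {1}(symfP (symvalP p)) comp_mpolyEX.
  rewrite rmorph_sum; apply: eq_bigr => m _ /=.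
  congr (_ *: _).
  rewrite comp_mpolyX rmorph_prod; apply: eq_bigr => i _ /=.
  by rewrite rmorphXn tnth_mktuple.
rewrite -[_ \in _]/(_ \in in_generated S).
apply: rpred_sum => m _; apply: rpredZ; apply: rpred_prod => i _.
by apply/rpredX/mem_generated; exists i.+1 => //=; apply: ltn_ord.
Qed.

(** * Minimality of generating families of N elements *)

Definition dirderiv {K : fieldType} {N : nat} (x v : 'I_N -> K)
    (p : {mpoly K[N]}) : K :=
  \sum_i v i * (p^`M(i)).@[x].

Lemma dirderivM {K : fieldType} {N : nat} (x v : 'I_N -> K) (p q : {mpoly K[N]}) :
  dirderiv x v (p * q) = dirderiv x v p * q.@[x] + p.@[x] * dirderiv x v q.
Proof.
rewrite /dirderiv mulr_suml mulr_sumr -big_split /=; apply: eq_bigr => i _.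
by rewrite mderivM mevalD !mevalM mulrDr !mulrA [_ * v i]mulrC.
Qed.

Lemma dirderiv_psym {K : fieldType} {N : nat} (x v : 'I_N -> K) k :
  dirderiv x v (psym K N k.+1) = k.+1%:R * \sum_i v i * x i ^+ k.
Proof.
rewrite /dirderiv mulr_sumr; apply: eq_bigr => i _; rewrite mulrCA; congr (_ * _).
rewrite /psym (raddf_sum (mderiv i)) (raddf_sum (meval x)) (bigD1 i) //=.
rewrite big1 => [|j ji].
  rewrite addr0 mpolyXn mderivX mulmnE mnm1E eqxx mul1n mevalZ mevalX.
  rewrite (bigD1 i) //= big1 => [|j ji].
    by rewrite mnmBE mulmnE mnm1E eqxx mul1n subn1 mulr1.
  by rewrite mnmBE mulmnE mnm1E eq_sym (negPf ji) expr0.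
by rewrite mpolyXn mderivX mulmnE mnm1E (negPf ji) mul0n scale0r raddf0.
Qed.

(** The values [\sum_i v_i x_i ^ k] for [k < N] are the entries of the product
of [v] with a Vandermonde matrix of distinct nodes. *)
Lemma dirderiv_separates {K : fieldType} {N : nat} (x v : 'I_N -> K) :
  [pchar K] =i pred0 -> injective x ->
  (forall k, (k < N)%N -> dirderiv x v (psym K N k.+1) = 0) -> forall i, v i = 0.
Proof.
move=> /pcharf0P char0 injx dv0 i.
pose V := (Vandermonde N (\row_j x j))^T.
have detV : \det V != 0.
  rewrite det_tr det_Vandermonde; apply/prodf_neq0 => j _.
  apply/prodf_neq0 => k jk; rewrite !mxE subr_eq0 (inj_eq injx).
  by apply: contraTneq jk => ->; rewrite ltnn.
have vV : (\row_j v j) *m V = 0.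
  apply/rowP => k; rewrite !mxE; have := dv0 k (ltn_ord k).
  rewrite dirderiv_psym => /eqP; rewrite mulf_eq0 char0 /= => /eqP sum0.
  by rewrite -[RHS]sum0; apply: eq_bigr => j _; rewrite !mxE.
apply/eqP; apply: contraNT detV => vi0; apply/det0P; exists (\row_j v j) => //.
by apply: contraNneq vi0 => /rowP/(_ i); rewrite !mxE => ->.
Qed.

(** A proper subset misses some [f m0].  Replacing the gradient of [f m0] by a
zero column in the matrix of the gradients makes it singular; a kernel vector
[v] is a direction along which the derivative vanishes on the whole subset,
hence on everything generated by it, in particular on all power sums. *)
Lemma generating_family_minimal {K : fieldType} {N : nat} (f : nat -> Sym K N) :
  [pchar K] =i pred0 ->
  generates [set f m | m in [set m | (1 <= m <= N)%N]] ->
  minimal_generating [set f m | m in [set m | (1 <= m <= N)%N]].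
Proof.
move=> char0 genf; split=> // T [Tf nfT] genT.
have [m0 /andP[m0_gt0 m0N] Tm0] : exists2 m, (1 <= m <= N)%N & ~ T (f m).
  apply/not_exists2P => fT; apply: nfT => _ [m /= mN <-].
  by case: (fT m) => [//|] /contrapT.
pose x (i : 'I_N) : K := i%:R.
have injx : injective x.
  move=> i j; wlog ij : i j / (i <= j)%N => [hw /[dup] xij /esym xji|].
    by case/orP: (leq_total i j) => /hw; [apply|move=> ->].
  move/eqP; rewrite eq_sym -subr_eq0 -natrB // => /eqP; move/pcharf0P: char0 => char0.
  move/eqP; rewrite char0 subn_eq0 => ji; apply/val_inj/eqP.
  by rewrite eqn_leq ij.
pose G : 'M[K]_N := \matrix_(i, j)
  if j.+1 == m0 then 0 else ((f j.+1 : {mpoly K[N]})^`M(i)).@[x].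
have : \det G == 0.
  have j0N : (m0.-1 < N)%N by rewrite prednK.
  rewrite (expand_det_col _ (Ordinal j0N)) big1 // => i _.
  by rewrite mxE /= prednK // eqxx mul0r.
case/det0P => v v0 vG.
pose d (p : Sym K N) := dirderiv x (v 0) p.
have dT p : T p -> d p = 0.
  move=> Tp; have [m /= /andP[m_gt0 mN] fm] := Tf _ Tp.
  have mm0 : m != m0 by apply/eqP => mm0; apply: Tm0; rewrite -mm0 fm.
  have jN : (m.-1 < N)%N by rewrite prednK.
  have /rowP/(_ (Ordinal jN)) := vG; rewrite !mxE => sum0; rewrite -[RHS]sum0.
  rewrite /d /dirderiv; apply: eq_bigr => i _.
  by rewrite mxE /= prednK // (negPf mm0) fm.
case/eqP: v0; apply/rowP => i; rewrite [RHS]mxE.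
apply: (@dirderiv_separates _ _ x (v 0)) => // k kN.
have: generated_algebra T (pS K N k.+1) by rewrite genT.
apply: (@generated_min _ _ T [set p | d p = 0]) => //.
split=> [|a p q|p q]; rewrite !inE /d /=.
- by rewrite /dirderiv big1 // => j _; rewrite -mpolyC1 mderivC raddf0 mulr0.
- move=> p0 q0; transitivity (a * d p + d q); last by rewrite /d p0 q0 mulr0 addr0.
  rewrite /d /dirderiv mulr_sumr -big_split; apply: eq_bigr => j _ /=.
  by rewrite mderivD mderivZ mevalD mevalZ mulrDr mulrCA.
- by move=> p0 q0; rewrite dirderivM p0 q0 mul0r mulr0 addr0.
Qed.

(** * Newton's identities *)

(** The logarithmic derivative of [\prod_i (1 + x_i t)] is the power series
[\sum_i x_i / (1 + x_i t)]; expanding it up to degree [m] gives an identity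
between polynomials modulo [t ^ m], which is proved one factor at a time. *)
Lemma deriv_prod_linear {L : comNzRingType} {I : Type} (x : I -> L) (r : seq I)
    (m : nat) :
  exists R : {poly L},
    (\prod_(i <- r) (1 + x i *: 'X))^`() =
    \prod_(i <- r) (1 + x i *: 'X) *
      (\sum_(i <- r) \sum_(j < m) (x i * (- x i) ^+ j) *: 'X^j) + 'X^m * R.
Proof.
elim: r => [|i r [R IH]].
  by exists 0; rewrite !big_nil derivC !mulr0 addr0.
pose c := (x i)%:P; set E := \prod_(i <- r) _ in IH *.
set S := \sum_(j <- r) _ in IH *.
have cX : x i *: 'X = c * 'X by rewrite mul_polyC.
exists ((1 + c * 'X) * R + c * (- c) ^+ m * E).
rewrite !big_cons -/E -/S cX derivM {}IH derivD derivM !derivE.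
have -> : \sum_(j < m) (x i * (- x i) ^+ j) *: 'X^j =
    c * \sum_(j < m) (- (c * 'X)) ^+ j :> {poly L}.
  rewrite mulr_sumr; apply: eq_bigr => j _.
  by rewrite -mul_polyC polyCM rmorphXn rmorphN /= -mulrA -exprMn mulNr.
(* The geometric sum stands for 1 / (1 + c X) modulo X ^ m. *)
have geo : (1 + c * 'X) * \sum_(j < m) (- (c * 'X)) ^+ j =
    1 - (- c) ^+ m * 'X^m.
  have := subrX1 (- (c * 'X)) m; rewrite -{1}mulNr exprMn => /(congr1 -%R).
  by rewrite opprB => ->; ring.
set T := \sum_(j < m) _ in geo *.
transitivity (E * c * ((1 + c * 'X) * T + (- c) ^+ m * 'X^m)
    + (1 + c * 'X) * (E * S + 'X^m * R)); last by ring.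
by rewrite geo; ring.
Qed.

(** Comparison of the coefficients of degree [k] in [deriv_prod_linear], at
precision [m = k + 1]. *)
Lemma newton_identity {L : comNzRingType} {N : nat} (x : 'I_N -> L) (k : nat) :
  let e j := (\prod_(i < N) (1 + x i *: 'X))`_j in
  e k.+1 *+ k.+1 = \sum_(j < k.+1) (-1) ^+ j * e (k - j)%N * \sum_i x i ^+ j.+1.
Proof.
move=> e; have [R] := deriv_prod_linear x (index_enum 'I_N) k.+1.
move/(congr1 (fun p : {poly L} => p`_k)).
rewrite coef_deriv coefD coefXnM ltnSn addr0 exchange_big.
have -> : \sum_(j < k.+1) \sum_i (x i * (- x i) ^+ j) *: 'X^j =
    \poly_(j < k.+1) \sum_i x i * (- x i) ^+ j.
  by rewrite poly_def; apply: eq_bigr => j _; rewrite scaler_suml.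
rewrite coefMr => -> /=; apply: eq_bigr => j _.
rewrite coef_poly ltn_ord -mulrA mulrCA.
congr (_ * _); rewrite mulr_sumr; apply: eq_bigr => i _.
by rewrite (exprNn (x i)) mulrCA exprS.
Qed.

Lemma mmap_id {K : fieldType} {N : nat} (p : {mpoly K[N]}) :
  mmap (@mpolyC N K) (fun i => 'X_i) p = p.
Proof.
rewrite [RHS]mpolyE; apply: eq_bigr => m _; rewrite mul_mpolyC.
by congr (_ *: _); rewrite mmap1_id.
Qed.

Lemma mesymE_prod (K : fieldType) (N k : nat) :
  mesym N K k = (\prod_(i < N) (1 + 'X_i *: 'X) : {poly {mpoly K[N]}})`_k.
Proof. by rewrite -(eval_mesym (@mpolyC N K)) mmap_id. Qed.

Lemma psym_identity (K : fieldType) (N k : nat) :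
  mesym N K k.+1 *+ k.+1 =
  \sum_(j < k.+1) (-1) ^+ j * mesym N K (k - j) * psym K N j.+1.
Proof.
rewrite mesymE_prod newton_identity; apply: eq_bigr => j _.
by rewrite mesymE_prod.
Qed.

Lemma mcoeff_mulX {R : nzRingType} {N : nat} (b a : 'X_{1..N}) (p : {mpoly R[N]}) :
  (p * 'X_[b])@_a = if (b <= a)%MM then p@_(a - b) else 0.
Proof.
case: ifP => [/submK <-|nba]; first by rewrite addmC mcoeffMX addmC addmK.
rewrite mcoeffM big1 // => -[c d] /= /eqP acd.
rewrite mcoeffX; case: eqP => [bd|]; last by rewrite mulr0.
by move/negP: nba; case; rewrite acd bd; apply: lem_addl.
Qed.

(** The coefficient of a monomial [a] of degree [k + 1] is the sum of
[(-1) ^ #|J|] over the sets [J] of variables dividing [a], that is,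
the product over the variables of [1 - 1] or [1] according to whether they
occur in [a]; some variable occurs since the degree is positive. *)
Lemma alternating_mesym_hsym (K : fieldType) (N k : nat) :
  \sum_(j < k.+2) (-1) ^+ j * mesym N K j * hsym K N (k.+1 - j) = 0.
Proof.
apply/mpolyP => a; rewrite mcoeff0 raddf_sum /=.
transitivity (\sum_(j < k.+2) \sum_(J : {set 'I_N} | #|J| == j)
    if (mesym1 J <= a)%MM && (mdeg a == k.+1) then (-1) ^+ #|J| else 0 : K).
  apply: eq_bigr => j _; rewrite mesymE -mulrA mulrCA mulr_suml raddf_sum /=.
  apply: eq_bigr => J /eqP cJ; rewrite mulrC -mulrA.
  rewrite -(rmorph1 (@mpolyC N K)) -rmorphN -rmorphXn mcoeffCM mcoeff_mulX cJ.
  have [Ja|] := boolP (mesym1 J <= a)%MM; last by rewrite mulr0.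
  have dega : mdeg a = (mdeg (a - mesym1 J) + j)%N.
    by rewrite -{1}(submK Ja) mdegD mdeg_mesym1 cJ.
  rewrite mcoeff_hsym dega /= -(eqn_add2r j) subnK; last by rewrite -ltnS.
  by case: eqP => _; rewrite ?mulr1 ?mulr0.
have [dega|_] := eqVneq (mdeg a) k.+1; last first.
  by rewrite big1 // => j _; rewrite big1 // => J _; rewrite andbF.
transitivity (\sum_(J : {set 'I_N} | (mesym1 J <= a)%MM) (-1) ^+ #|J| : K).
  (* A set J dividing a has at most deg a = k + 1 elements, so inord is exact. *)
  rewrite (partition_big (fun J : {set 'I_N} => inord #|J| : 'I_k.+2) xpredT) //=.
  apply: eq_bigr => j _; rewrite -big_mkcondr /=; apply: eq_bigl => J.
  rewrite andbT andbC; have [Ja|//] := boolP (mesym1 J <= a)%MM.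
  have cJ : (#|J| <= k.+1)%N.
    by rewrite -dega -(submK Ja) mdegD mdeg_mesym1 leq_addl.
  by rewrite -val_eqE /= inordK.
have [i ai] : exists i, (0 < a i)%N.
  apply/existsP; apply: contraPT dega => /existsPn a0.
  by rewrite mdegE big1 // => i _; move: (a0 i); rewrite lt0n negbK => /eqP.
transitivity (\prod_(i < N) ((if (0 < a i)%N then -1 else 0) + 1 : K)).
  rewrite bigA_distr big_mkcond; apply: eq_bigr => J _.
  have [/mnm_lepP Ja|Ja] := boolP (mesym1 J <= a)%MM.
    rewrite -prodr_const [LHS]big_mkcond; apply: eq_bigr => j _.
    by case: ifP => // jJ; move: (Ja j); rewrite mnmE jJ => ->.
  have [j] : exists j, ~~ (mesym1 J j <= a j)%N.
    by apply/existsP; rewrite -negb_forall.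
  rewrite mnmE -ltnNge => aj; have jJ : j \in J by case: (j \in J) aj.
  by rewrite (bigD1 j) //= jJ ltnNge -ltnS (leq_trans aj (leq_b1 _)) mul0r.
by rewrite (bigD1 i) //= ai addNr mul0r.
Qed.

Lemma hsym_identity (K : fieldType) (N k : nat) :
  mesym N K k.+1 = (-1) ^+ k *
    \sum_(j < k.+1) (-1) ^+ j * mesym N K j * hsym K N (k.+1 - j).
Proof.
have hsym0 : hsym K N 0 = 1.
  by apply/mpolyP => a; rewrite mcoeff_hsym mcoeff1 mdeg_eq0.
have := alternating_mesym_hsym K N k.
rewrite big_ord_recr /= subnn hsym0 mulr1 => /eqP; rewrite addr_eq0 => /eqP ->.
by rewrite exprS mulN1r mulNr opprK mulrA -exprMn mulrNN mulr1 expr1n mul1r.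
Qed.

(** * Expansion of the ez in the elementary symmetric polynomials *)

Lemma prod_linear_sum {L A : comNzRingType} (f : {rmorphism L -> A}) {n : nat}
    (y : 'I_n -> L) (a b : A) :
  \prod_(i < n) (b + f (y i) * a) =
  \sum_(J : {set 'I_n}) f (\prod_(i in J) y i) * a ^+ #|J| * b ^+ (n - #|J|).
Proof.
under eq_bigr => i _ do rewrite addrC.
rewrite bigA_distr; apply: eq_bigr => J _; rewrite (bigID (mem J)) /=; congr (_ * _).
  rewrite rmorph_prod -prodr_const -big_split; apply: eq_bigr => i /= iJ.
  by rewrite iJ.
have -> : (n - #|J| = #|~: J|)%N by rewrite [RHS]cardsCs finset.setCK card_ord.
rewrite -prodr_const; apply: eq_big => [i|i /negPf -> //].
by rewrite inE.
Qed.

Lemma coef_prod_linear {L : comNzRingType} {n : nat} (y : 'I_n -> L) (k : nat) :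
  (\prod_(i < n) (1 + y i *: 'X))`_k =
  \sum_(J : {set 'I_n} | #|J| == k) \prod_(i in J) y i.
Proof.
under eq_bigr => i _ do rewrite -mul_polyC.
rewrite (prod_linear_sum (@polyC L)) coef_sum [RHS]big_mkcond.
apply: eq_bigr => J _; rewrite expr1n mulr1 coefCM coefXn eq_sym.
by case: eqP => _; rewrite ?mulr1 ?mulr0.
Qed.

(** Homogenization of [\prod_i (1 + y_i t) = \sum_k e_k(y) t ^ k]. *)
Lemma prod_linear_homog {L A : comNzRingType} (f : {rmorphism L -> A}) {n : nat}
    (y : 'I_n -> L) (a b : A) :
  \prod_(i < n) (b + f (y i) * a) =
  \sum_(k < n.+1) f (\prod_(i < n) (1 + y i *: 'X))`_k * a ^+ k * b ^+ (n - k).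
Proof.
rewrite prod_linear_sum.
rewrite (partition_big (fun J : {set 'I_n} => inord #|J| : 'I_n.+1) xpredT) //=.
apply: eq_bigr => k _; rewrite coef_prod_linear rmorph_sum !mulr_suml.
have cardE (J : {set 'I_n}) : (inord #|J| == k) = (#|J| == k).
  rewrite -val_eqE /= inordK // ltnS.
  by rewrite -[n in (_ <= n)%N]card_ord max_card.
rewrite (eq_bigl _ _ cardE); by apply: eq_bigr => J /eqP ->.
Qed.

(** [prod_linear_homog] with [a = 'X] and [b = 1 + 'X^2]. *)
Lemma coef_prod_quadratic {L : comNzRingType} {n : nat} (y : 'I_n -> L) (m : nat) :
  (\prod_(i < n) (1 + y i *: 'X + 'X^2))`_m =
  \sum_(k < n.+1) ('X^k * (1 + 'X^2) ^+ (n - k) : {poly L})`_m *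
    (\prod_(i < n) (1 + y i *: 'X))`_k.
Proof.
under eq_bigr => i _ do rewrite addrAC -mul_polyC.
rewrite (prod_linear_homog (@polyC L)) coef_sum; apply: eq_bigr => k _.
by rewrite -mulrA coefCM mulrC.
Qed.

Definition ez_coef (K : fieldType) (n m k : nat) : K :=
  ('X^k * (1 + 'X^2) ^+ (n - k) : {poly K})`_m.

(** The factors of [x_i] and [x_i^-1] are paired by
[(1 + x t) (1 + x^-1 t) = 1 + (x + x^-1) t + t^2]. *)
Lemma ez_expand (K : fieldType) (n m : nat) :
  ez K n m = \sum_(k < n.+1) ez_coef K n m k *: eS K n k.
Proof.
apply: Phi_unique; rewrite (raddf_sum (@symval K n)) (raddf_sum (@eval_sum K n)) /=.
rewrite /eval_inv eval_mesym big_split_ord /=.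
rewrite -big_split /=.
under eq_bigr => i _.
  rewrite (unsplitK (inl i)) (unsplitK (inr i)).
  have -> : (1 + xvar K i *: 'X) * (1 + (xvar K i)^-1 *: 'X) =
      1 + (xvar K i + (xvar K i)^-1) *: 'X + 'X^2 :> {poly {fraction {mpoly K[n]}}}.
    rewrite mulrDl mul1r mulrDr mulr1 -scalerAl -scalerAr scalerA.
    by rewrite mulfV ?xvar_neq0 // scale1r -expr2 scalerDl !addrA;
      congr (_ + _); rewrite addrAC.
  over.
rewrite coef_prod_quadratic; apply: eq_bigr => k _.
rewrite eval_sumZ /eval_sum eval_mesym; congr (_ * _).
rewrite /ez_coef -coef_map rmorphM rmorphXn rmorphXn rmorphD rmorph1 /=.
by rewrite map_polyXn map_polyX.
Qed.

(** * The three generating families *)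

Lemma ez0 (K : fieldType) (n : nat) : ez K n 0 = 1.
Proof.
rewrite -[RHS](rmorph1 (@Phi K n)); congr (Phi _).
by apply/val_inj; rewrite /= mesym0E.
Qed.

(** The matrix [ez_coef K n] is triangular with ones on the diagonal, because
['X^k * (1 + 'X^2) ^+ (n - k)] has lowest term ['X^k]. *)
Lemma ez_generates (K : fieldType) (n : nat) :
  generates [set ez K n m | m in [set m | (1 <= m <= n)%N]].
Proof.
apply: generates_trans (eS_generates K n) => _ [m /= /andP[_ mn] <-].
elim/ltn_ind: m mn => m IH mn.
have -> : eS K n m = ez K n m - \sum_(k < m) ez_coef K n m k *: eS K n k.
  rewrite ez_expand -(big_mkord xpredT (fun k => ez_coef K n m k *: eS K n k)).
  rewrite (big_cat_nat (n := m)) ?(leqW mn) //= big_mkord addrAC subrr add0r.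
  rewrite big_ltn ?ltnS // big_nat big1 => [|k /andP[mk _]].
    rewrite addr0 /ez_coef coefXnM ltnn subnn -horner_coef0 !hornerE.
    by rewrite expr0n /= addr0 expr1n scale1r.
  by rewrite /ez_coef coefXnM mk scale0r.
have [->|m_gt0] := posnP m.
  by rewrite big_ord0 subr0 ez0 rpred1.
apply: rpredB; first by apply: mem_generated; exists m => //=; rewrite m_gt0.
apply: rpred_sum => k _; apply/rpredZ/IH => //.
exact: leq_trans (ltnW (ltn_ord k)) mn.
Qed.

Lemma ez_hz_identity (K : fieldType) (n k : nat) :
  ez K n k.+1 =
  (-1) ^+ k * \sum_(j < k.+1) (-1) ^+ j * ez K n j * hz K n (k.+1 - j).
Proof.
have: eS K (n + n) k.+1 = (-1) ^+ k *
    \sum_(j < k.+1) (-1) ^+ j * eS K (n + n) j * hS K (n + n) (k.+1 - j).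
  apply/val_inj; rewrite /= hsym_identity rmorph_sum rmorphXn rmorphN1.
  congr (_ * _); apply: eq_bigr => j _.
  by rewrite !(rmorphM (@symval K _)) rmorphXn rmorphN1.
move/(congr1 (@Phi K n)); rewrite rmorphM rmorph_sum rmorphXn rmorphN1 => img.
rewrite [LHS]img; congr (_ * _).
by apply: eq_bigr => j _; rewrite !rmorphM rmorphXn rmorphN1.
Qed.

Lemma ez_pz_identity (K : fieldType) (n k : nat) :
  ez K n k.+1 *+ k.+1 =
  \sum_(j < k.+1) (-1) ^+ j * ez K n (k - j) * pz K n j.+1.
Proof.
have: eS K (n + n) k.+1 *+ k.+1 =
    \sum_(j < k.+1) (-1) ^+ j * eS K (n + n) (k - j) * pS K (n + n) j.+1.
  apply/val_inj; rewrite /= (rmorphMn (@symval K _)) rmorph_sum /= psym_identity.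
  by apply: eq_bigr => j _; rewrite rmorphXn rmorphN1.
move/(congr1 (@Phi K n)); rewrite rmorphMn rmorph_sum => ->.
by apply: eq_bigr => j _; rewrite !rmorphM rmorphXn rmorphN1.
Qed.

Lemma hz_generates (K : fieldType) (n : nat) :
  generates [set hz K n m | m in [set m | (1 <= m <= n)%N]].
Proof.
apply: generates_trans (ez_generates K n) => _ [m /= /andP[_ mn] <-].
elim/ltn_ind: m mn => -[|m] IH mn; first by rewrite ez0 rpred1.
rewrite ez_hz_identity; apply/rpredM; first exact/rpredX/rpredN1.
apply: rpred_sum => j _; apply/rpredM; first apply/rpredM.
- exact/rpredX/rpredN1.
- by apply: IH => //; apply: leq_trans (ltnW (ltn_ord j)) mn.
apply: mem_generated; exists (m.+1 - j)%N => //=.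
by rewrite subn_gt0 ltn_ord (leq_trans (leq_subr _ _) mn).
Qed.

Lemma pz_generates (K : fieldType) (n : nat) : [pchar K] =i pred0 ->
  generates [set pz K n m | m in [set m | (1 <= m <= n)%N]].
Proof.
move=> /pcharf0P char0.
apply: generates_trans (ez_generates K n) => _ [m /= /andP[_ mn] <-].
elim/ltn_ind: m mn => -[|m] IH mn; first by rewrite ez0 rpred1.
have -> : ez K n m.+1 = (m.+1%:R)^-1 *: (ez K n m.+1 *+ m.+1).
  by rewrite -scaler_nat scalerA mulVf ?scale1r // char0.
rewrite ez_pz_identity; apply/rpredZ/rpred_sum => j _.
apply/rpredM; first apply/rpredM.
- exact/rpredX/rpredN1.
- by apply: IH; rewrite ?ltnS ?leq_subr // (leq_trans (leq_subr _ _)) // ltnW.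
by apply: mem_generated; exists j.+1 => //=; apply: leq_trans mn.
Qed.

(** The image of a homomorphism of algebras is a subalgebra, and this one
contains the generators [ez]. *)
Lemma Phi_surjective (K : fieldType) (n : nat) (Q : Sym K n) :
  exists P : Sym K (n + n), Phi P = Q.
Proof.
suff [P _ PQ] : range (@Phi K n) Q by exists P.
have: generated_algebra [set ez K n m | m in [set m | (1 <= m <= n)%N]] Q.
  by rewrite ez_generates.
apply: (@generated_min _ _ _ (range (@Phi K n))) => [|_ [m _ <-]].
  split=> [|a _ _ /set_mem[P _ <-] /set_mem[P' _ <-]|
            _ _ /set_mem[P _ <-] /set_mem[P' _ <-]].
  - by apply/mem_set; exists 1 => //; rewrite rmorph1.
  - by apply/mem_set; exists (a *: P + P') => //; rewrite linearP.
  - by apply/mem_set; exists (P * P') => //; rewrite rmorphM.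
by exists (eS K (n + n) m).
Qed.

Theorem theorem1p7 (R : realType) (n : nat) (hn : (1 <= n)%N) :
  [/\ minimal_generating [set ez R[i] n m | m in [set m | (1 <= m <= n)%N]],
      minimal_generating [set hz R[i] n m | m in [set m | (1 <= m <= n)%N]],
      minimal_generating [set pz R[i] n m | m in [set m | (1 <= m <= n)%N]]
    & forall Q : Sym R[i] n, exists P : Sym R[i] (n + n), Phi P = Q].
Proof.
have char0 := pchar_num R[i].
split; [| | |exact: Phi_surjective]; apply: generating_family_minimal => //.
- exact: ez_generates.
- exact: hz_generates.
- exact: pz_generates.
Qed.
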